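(* Let $n\ge 1$ and let $A$ be a semi-algebraic subset of $\mathbb{M}^n$ (identified with $\mathbb{R}^{2n}$). Then there exist a linkage $\mathcal{L}$ in the Minkowski plane $\mathbb{M}$ and a set $W$ of $n$ vertices of $\mathcal{L}$ such that $\mathrm{Conf}_{\mathbb{M}}^W(\mathcal{L})=A$ (identifying $\mathbb{M}^W$ with $\mathbb{M}^n$ by an ordering of $W$). When $A$ is algebraic, one can choose $\mathcal{L}$ and $W$ such that moreover the restriction map $\mathrm{Conf}_{\mathbb{M}}(\mathcal{L})\to \mathrm{Conf}_{\mathbb{M}}^W(\mathcal{L})=A$, $\phi\mapsto\phi|_W$, is a smooth finite trivial covering.
   Context: The Minkowski plane $\mathbb{M}$ is $\mathbb{R}^2$ with coordinates $(x,t)$ and the ''distance'' $\delta((x_1,t_1),(x_2,t_2))=\sqrt{(x_2-x_1)^2-(t_2-t_1)^2}\in\mathbb{R}_{\ge0}\cup i\mathbb{R}_{\ge0}$ (the square root of a negative number $-s$ is $i\sqrt{s}$). A linkage $\mathcal{L}$ in $\mathbb{M}$ is a finite connected graph $(V,E)$ together with a length function $l:E\to\mathbb{R}_{\ge0}\cup i\mathbb{R}_{\ge0}$, a non-empty set $F\subseteq V$ of fixed vertices and a map $\phi_0:F\to\mathbb{M}$. A realization of $\mathcal{L}$ is a map $\phi:V\to\mathbb{M}$ with $\phi|_F=\phi_0$ and $\delta(\phi(v_1),\phi(v_2))=l(v_1v_2)$ for every edge $v_1v_2\in E$. For $W\subseteq V$, $\mathrm{Conf}_{\mathbb{M}}^W(\mathcal{L})=\{\phi|_W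 : \phi \text{ realization of } \mathcal{L}\}\subseteq\mathbb{M}^W$ is the partial configuration space, and $\mathrm{Conf}_{\mathbb{M}}(\mathcal{L})=\mathrm{Conf}_{\mathbb{M}}^V(\mathcal{L})$ is the configuration space. An algebraic subset of $\mathbb{R}^k$ is a set $f^{-1}(0)$ with $f:\mathbb{R}^k\to\mathbb{R}^m$ polynomial. A semi-algebraic subset of $\mathbb{R}^k$ is the image of an algebraic subset of some $\mathbb{R}^N$ ($N\ge k$) under the projection to the first $k$ coordinates. These notions are transported to $\mathbb{M}^n$ through $\mathbb{M}^n=(\mathbb{R}^2)^n=\mathbb{R}^{2n}$. These sets need not be manifolds: a smooth map on a subset of a manifold means the restriction of a smooth map defined on the ambient manifold; diffeomorphisms between such subsets are bijections smooth in both directions. A smooth finite trivial covering $X\to A$ is a map which, up to a diffeomorphism $X\cong A\times S$ over $A$ with $S$ a finite discrete set, is the projection $A\times S\to A$. *)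

(* Defs.v *)
From HB Require Import structures.
From mathcomp Require Import all_boot all_order all_algebra complex.
From mathcomp Require mpoly.
From mathcomp Require Import all_classical all_reals all_analysis.

Set Implicit Arguments.
Unset Strict Implicit.
Unset Printing Implicit Defensive.
Import Order.TTheory GRing.Theory Num.Theory.
Import numFieldNormedType.Exports.
Local Open Scope classical_set_scope.
Local Open Scope ring_scope.
Local Open Scope complex_scope.

(* The coordinates of p : mink R are x = p 0 0 and t = p 0 1. *)
Notation mink R := 'rV[R]_2.

(* A point of M^k is a matrix whose i-th row is its i-th component. The
   row-major vectorization mxvec is then the identification M^k = R^(2k). *)
Notation mink_pow R k := 'M[R]_(k, 2).

Definition delta (R : realType) (p q : mink R) : R[i] :=
  let s := (q 0 0 - p 0 0) ^+ 2 - (q 0 1 - p 0 1) ^+ 2 in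
  if 0 <= s then (Num.sqrt s)%:C else (Num.sqrt (- s))*i.

(* Membership in R_(>= 0) `|` i R_(>= 0). *)
Definition is_length (R : realType) (z : R[i]) : Prop :=
  (exists2 a : R, 0 <= a & z = a%:C) \/ (exists2 a : R, 0 <= a & z = a*i).

(* The values of len outside the edges, and of fixed_pos outside the fixed
   vertices, are never used. *)
Record linkage (R : realType) := Linkage {
  vertex :> finType;
  edge : rel vertex;
  edge_sym : symmetric edge;
  edge_irr : irreflexive edge;
  edge_conn : forall u v : vertex, connect edge u v;
  len : vertex -> vertex -> R[i];
  len_sym : forall u v, edge u v -> len u v = len v u;
  len_ok : forall u v, edge u v -> is_length (len u v);
  fixed : {set vertex};
  fixed_neq0 : exists v, v \in fixed;
  fixed_pos : vertex -> mink R
}.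

(* A map V -> M is encoded as an element of M^#|V|, through the canonical
   enumeration of V. *)
Definition pos (R : realType) (V : finType) (phi : mink_pow R #|V|) (v : V) :
    mink R :=
  row (enum_rank v) phi.

Definition realization (R : realType) (L : linkage R)
    (phi : mink_pow R #|L|) : Prop :=
  (forall v, v \in fixed L -> pos phi v = fixed_pos v) /\
  (forall u v, edge u v -> delta (pos phi u) (pos phi v) = len u v).

Definition Conf (R : realType) (L : linkage R) : set (mink_pow R #|L|) :=
  [set phi | realization phi].
Arguments Conf {R} L.

(* An n-element set W of vertices together with an ordering is an injection
   w : 'I_n -> V; phi|_W is then the element of M^n whose i-th component is
   the position of w i. *)
Definition restr (R : realType) (V : finType) (n : nat) (w : 'I_n -> V)
    (phi : mink_pow R #|V|) : mink_pow R n :=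
  \matrix_(i < n) pos phi (w i).

Definition partial_Conf (R : realType) (L : linkage R) (n : nat)
    (w : 'I_n -> L) : set (mink_pow R n) :=
  restr w @` Conf L.

Definition algebraic (R : realType) (k : nat) (X : set 'rV[R]_k) : Prop :=
  exists (m : nat) (f : 'I_m -> mpoly.mpoly k R),
    X = [set x : 'rV[R]_k | forall j, mpoly.meval (x 0) (f j) = 0].

Definition semialgebraic (R : realType) (k : nat) (X : set 'rV[R]_k) : Prop :=
  exists (d : nat) (Y : set 'rV[R]_(k + d)), algebraic Y /\ X = lsubmx @` Y.

Definition mink_algebraic (R : realType) (n : nat) (A : set (mink_pow R n)) :
    Prop :=
  algebraic (mxvec @` A).

Definition mink_semialgebraic (R : realType) (n : nat)
    (A : set (mink_pow R n)) : Prop :=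
  semialgebraic (mxvec @` A).

(* Class C^k. Between finite-dimensional spaces, f is C^(k+1) iff it is
   differentiable and x |-> 'd f x v = 'D_v f x is C^k for every v. Below, U
   and V are always spaces of matrices, or a product of one with R. *)
Fixpoint Ck (R : realType) (U V : normedModType R) (k : nat) (f : U -> V) :
    Prop :=
  if k is k'.+1 then
    (forall x, differentiable f x) /\
    (forall v : U, Ck k' (fun x => 'D_v f x))
  else continuous f.

Definition smooth (R : realType) (U V : normedModType R) (f : U -> V) : Prop :=
  forall k, Ck k f.

Definition smooth_on (R : realType) (U V : normedModType R) (X : set U)
    (f : U -> V) : Prop :=
  exists2 g : U -> V, smooth g & forall x, X x -> f x = g x.

Definition diffeomorphism (R : realType) (U V : normedModType R) (X : set U)
    (Y : set V) (f : U -> V) : Prop :=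
  set_bij X Y f /\ smooth_on X f /\
  exists g : V -> U, (forall x, X x -> g (f x) = x) /\ smooth_on Y g.

(* The finite discrete set S is realized as a finite set of real numbers, so
   that A `*` S is a subset of the vector space V * R. *)
Definition smooth_finite_trivial_covering (R : realType)
    (U V : normedModType R) (X : set U) (A : set V) (p : U -> V) : Prop :=
  exists (S : set R) (h : U -> V * R),
    [/\ finite_set S,
        diffeomorphism X (A `*` S) h &
        forall x, X x -> (h x).1 = p x].

(* Main.v *)
Require Import Defs.
From HB Require Import structures.
From mathcomp Require Import all_boot all_order all_algebra complex.
From mathcomp Require Import all_classical all_reals all_analysis.
From mathcomp Require mpoly.
From mathcomp Require Import ring lra.
Set Implicit Arguments.
Unset Strict Implicit.
Unset Printing Implicit Defensive.
Import Order.TTheory GRing.Theory Num.Theory.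
Import numFieldNormedType.Exports.
Local Open Scope classical_set_scope.
Local Open Scope ring_scope.

(** In the light coordinates [a = x + t], [b = x - t] an edge imposes
    [(a_u - a_v) * (b_u - b_v) = c], where [c] can be any real number,
    including 0. The proof is a compilation of polynomial equations into such
    bilinear ones.

    Null edges ([c = 0]) make coordinates into reusable variables: two points
    on distinct lines [b = const] that are null to each other have the same
    [a], and a third point null to both of them has it too. Hence finitely many
    A-wires (values of [a]) and B-wires (values of [b]) can be combined freely:
    the linkage whose vertices are all pairs of wires, joined by a null edge
    whenever they share a wire, has as configurations exactly the assignments
    of reals to wires ([grid_Conf]). Any further edge is then an equation
    [(al i - al i') * (be j - be j') = c], called a bar.

    It remains to do arithmetic with bars. A bar whose factor on the B side is
    known and never zero determines a difference of A-wires, so the sums of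
    inverses of nonvanishing quantities are computable. The difficulty is that
    an input [x] ranges over all of R and vanishes somewhere. The gate
    therefore parametrizes the real line by an interval:
    [x = 1 / (1 - rho) - 1 / rho] is a bijection from (0, 1) onto R. The same
    equation has a second solution [rho] outside [0, 1], which escapes to
    infinity at [x = 0] and would spoil the covering. It is removed by two more
    bars, which amount to [s = (2 sg - 1) ^ 2] for
    [s = 1 / rho + 1 / (1 - rho)], a number that is positive exactly on the
    interval. These bars cost one choice of sign for [sg], and the two choices
    never meet since [s >= 4]. From the inverses of [rho], [1 - rho], [s] and
    [s - 1], all of them nonvanishing, one gets the value of [x] on a B-wire
    and [y + lam * x + mu * x ^ 2] for any A-wire [y] ([gate_barsP]).

    Such gates compute every polynomial, products being obtained by
    polarization. For an algebraic set, one gate for each point moves its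
    second light coordinate to a B-wire, further gates compute the sum of the
    squares of the equations, and a last bar makes that sum vanish
    ([Conf_program]). A configuration is thus a point of [A] together with one
    sign per gate; it depends smoothly on them through square roots and
    inverses of positive functions, and the signs are read off smoothly from
    the configuration, so the restriction map is a trivial covering
    ([sign_covering]). A semi-algebraic set is a projection of an algebraic
    one, and the extra variables can be taken as further points of the plane,
    which are then forgotten. *)

(** * Smooth functions *)

Section SmoothCalculus.
Variables (R : realType) (U : normedModType R).

Lemma Ck_pred (V : normedModType R) k (f : U -> V) : Ck k.+1 f -> Ck k f.
Proof.
elim: k f => [|k IH] f [df Df]; first by move=> x; exact: differentiable_continuous.
by split=> // v; apply: IH.
Qed.

(** A constant has derivative 0, which is again a constant; this closes the
    induction on the order. *)
Lemma smooth_cst (V : normedModType R) (c : V) : smooth (fun _ : U => c).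
Proof.
move=> k; elim: k c => [|k IH] c; first exact: cst_continuous.
split=> [x|v]; first exact: differentiable_cst.
have -> : (fun x : U => 'D_v (fun=> c) x) = (fun=> 0).
  by apply/funext => x; rewrite derive_cst.
exact: IH.
Qed.

Lemma smooth_linear (V : normedModType R) (f : {linear U -> V}) :
  continuous f -> smooth f.
Proof.
move=> cf [|k] //; split=> [x|v]; first exact: linear_differentiable.
have -> : (fun x : U => 'D_v f x) = (fun=> f v).
  apply/funext => x; rewrite deriveE; last exact: linear_differentiable.
  by rewrite diff_lin.
exact: smooth_cst.
Qed.

Lemma CkD (V : normedModType R) k (f g : U -> V) :
  Ck k f -> Ck k g -> Ck k (fun x => f x + g x).
Proof.
elim: k f g => [|k IH] f g.
  by move=> cf cg x; apply: cvgD; [exact: cf | exact: cg].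
move=> [df Df] [dg Dg]; split=> [x|v]; first exact: differentiableD.
have -> : (fun x : U => 'D_v (fun y => f y + g y) x) =
    (fun x => 'D_v f x + 'D_v g x).
  by apply/funext => x; rewrite deriveD//; exact: diff_derivable.
by apply: IH; [exact: Df | exact: Dg].
Qed.

(** The derivative of a product involves the factors themselves, one order
    lower than given: hence the use of [Ck_pred]. *)
Lemma CkM k (f g : U -> R) :
  Ck k f -> Ck k g -> Ck k (fun x => f x * g x).
Proof.
elim: k f g => [|k IH] f g.
  by move=> cf cg x; apply: cvgM; [exact: cf | exact: cg].
move=> sf sg; have [cf cg] := (Ck_pred sf, Ck_pred sg).
move: sf sg => [df Df] [dg Dg]; split=> [x|v]; first exact: differentiableM.
have -> : (fun x : U => 'D_v (fun y => f y * g y) x) =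
    (fun x => f x * 'D_v g x + g x * 'D_v f x).
  by apply/funext => x; rewrite deriveM//; exact: diff_derivable.
by apply: CkD; apply: IH => //; [exact: Dg | exact: Df].
Qed.

Lemma CkZ (V : normedModType R) k (f : U -> R) (c : V) :
  Ck k f -> Ck k (fun x => f x *: c).
Proof.
elim: k f => [|k IH] f.
  by move=> cf x; apply: cvgZr_tmp; exact: cf.
move=> [df Df]; split=> [x|v]; first exact: differentiableZl.
have -> : (fun x : U => 'D_v (fun y => f y *: c) x) = (fun x => 'D_v f x *: c).
  apply/funext => x; rewrite !deriveE//; last exact: differentiableZl.
  by rewrite diffZl.
by apply: IH; exact: Df.
Qed.

Lemma derive_comp1 (f : U -> R) (p : R -> R) (x v : U) dp :
  differentiable f x -> is_derive (f x) 1 p dp ->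
  differentiable (fun y => p (f y)) x /\
  'D_v (fun y => p (f y)) x = dp * 'D_v f x.
Proof.
move=> df dpf.
have dp1 : differentiable p (f x) by apply/derivable1_diffP; exact: ex_derive.
have dc : differentiable (p \o f) x by exact: differentiable_comp.
split=> //; rewrite deriveE// deriveE// diff_comp//=.
rewrite deriv1E; last exact: ex_derive.
by rewrite /= derive1E (@derive_val _ _ _ _ _ _ _ dpf) mulrC.
Qed.

Lemma smoothD (V : normedModType R) (f g : U -> V) :
  smooth f -> smooth g -> smooth (fun x => f x + g x).
Proof. by move=> sf sg k; apply: CkD. Qed.

Lemma smoothM (f g : U -> R) :
  smooth f -> smooth g -> smooth (fun x => f x * g x).
Proof. by move=> sf sg k; apply: CkM. Qed.

Lemma smoothN (f : U -> R) : smooth f -> smooth (fun x => - f x).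
Proof.
move=> sf; have -> : (fun x => - f x) = (fun x => -1 * f x).
  by apply/funext => x; rewrite mulN1r.
by apply: smoothM => //; apply: smooth_cst.
Qed.

Lemma smoothB (f g : U -> R) :
  smooth f -> smooth g -> smooth (fun x => f x - g x).
Proof. by move=> sf sg; apply: smoothD => //; apply: smoothN. Qed.

Lemma smoothX (f : U -> R) n : smooth f -> smooth (fun x => f x ^+ n).
Proof.
move=> sf; elim: n => [|n IH].
  by under eq_fun do rewrite expr0; exact: smooth_cst.
by under eq_fun do rewrite exprS; exact: smoothM.
Qed.

(** The derivative of [1 / f] is [- (1 / f) * (1 / f) * f'], so the induction
    hypothesis on [1 / f] itself applies. *)
Lemma smoothV (f : U -> R) :
  (forall x, f x != 0) -> smooth f -> smooth (fun x => (f x)^-1).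
Proof.
move=> f0 sf; elim=> [|k IH].
  by move=> x; apply: cvgV; [exact: f0 | exact: (sf 0%N)].
have [df Df] := sf k.+1.
split=> [x|v]; first exact: differentiableV.
have -> : (fun x : U => 'D_v (fun y => (f y)^-1) x) =
    (fun x => -1 * ((f x)^-1 * (f x)^-1 * 'D_v f x)).
  apply/funext => x; rewrite deriveV//; last exact: diff_derivable.
  by rewrite -exprVn expr2 scaleNr mulN1r.
apply: CkM; first exact: smooth_cst.
by apply: CkM; [apply: CkM | exact: Df].
Qed.

(** The derivative of [sqrt f] is written [sqrt f / (2 f) * f'] rather than
    [f' / (2 sqrt f)]: [sqrt f] is covered by the induction hypothesis, and
    [1 / (2 f)] is already known to be smooth. *)
Lemma smooth_sqrt (f : U -> R) :
  (forall x, 0 < f x) -> smooth f -> smooth (fun x => Num.sqrt (f x)).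
Proof.
move=> f0 sf; elim=> [|k IH].
  move=> x; apply: (@continuous_comp _ _ _ f Num.sqrt); first exact: (sf 0%N).
  exact: sqrt_continuous.
have [df Df] := sf k.+1.
have Dsq x v := derive_comp1 v (df x) (is_derive1_sqrt (f0 x)).
split=> [x|v]; first by have [] := Dsq x 0.
have -> : (fun x : U => 'D_v (fun y => Num.sqrt (f y)) x) =
    (fun x => Num.sqrt (f x) * (2 * f x)^-1 * 'D_v f x).
  apply/funext => x; have [_ ->] := Dsq x v; congr (_ * _).
  have s0 : Num.sqrt (f x) != 0 by rewrite sqrtr_eq0 -ltNge.
  have fE := esym (sqr_sqrtr (ltW (f0 x))).
  by move: (Num.sqrt (f x)) s0 fE => s s0 ->; field.
apply: CkM; last exact: Df.
apply: CkM => //; apply: smoothV.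
  by move=> x; rewrite mulf_neq0// gt_eqF.
by apply: smoothM => //; exact: smooth_cst.
Qed.

Lemma smooth_sum (V : normedModType R) (I : finType) (f : I -> U -> V) :
  (forall i, smooth (f i)) -> smooth (fun x => \sum_i f i x).
Proof.
move=> sf; elim: (index_enum I) => [|i s IH].
  by under eq_fun do rewrite big_nil; exact: smooth_cst.
by under eq_fun do rewrite big_cons; exact: smoothD.
Qed.

Lemma smooth_prod (I : finType) (f : I -> U -> R) :
  (forall i, smooth (f i)) -> smooth (fun x => \prod_i f i x).
Proof.
move=> sf; elim: (index_enum I) => [|i s IH].
  by under eq_fun do rewrite big_nil; exact: smooth_cst.
by under eq_fun do rewrite big_cons; exact: smoothM.
Qed.

Lemma smooth_horner (p : {poly R}) (f : U -> R) :
  smooth f -> smooth (fun x => p.[f x]).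
Proof.
move=> sf; elim/poly_ind: p => [|p c IH].
  by under eq_fun do rewrite horner0; exact: smooth_cst.
under eq_fun do rewrite hornerMXaddC.
by apply: smoothD; [apply: smoothM | exact: smooth_cst].
Qed.

(** A map to matrices is a finite sum of scalar functions times constant
    matrices. *)
Lemma smooth_mx m n (f : U -> 'M[R]_(m, n)) :
  (forall i j, smooth (fun x => f x i j)) -> smooth f.
Proof.
move=> sf.
have -> : f = fun x => \sum_i \sum_j f x i j *: delta_mx i j.
  by apply/funext => x; rewrite -matrix_sum_delta.
apply: smooth_sum => i; apply: smooth_sum => j k; apply: CkZ.
exact: sf.
Qed.

Lemma smooth_pair (V W : normedModType R) (f : U -> V) (g : U -> W) :
  smooth f -> smooth g -> smooth (fun x => (f x, g x)).
Proof.
move=> sf sg k; move: (sf k) (sg k) => {sf sg}.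
elim: k f g => [|k IH] f g.
  by move=> cf cg x; apply: cvg_pair; [exact: cf | exact: cg].
move=> [df Df] [dg Dg]; split=> [x|v]; first exact: differentiable_pair.
have -> : (fun x : U => 'D_v (fun y => (f y, g y)) x) =
    (fun x => ('D_v f x, 'D_v g x)).
  apply/funext => x; rewrite !deriveE//; last exact: differentiable_pair.
  by rewrite diff_pair.
by apply: IH; [exact: Df | exact: Dg].
Qed.

(** The only composition needed on the right is with a projection; there the
    chain rule is [D_v (f o l) = (D_(l v) f) o l] and stays of the same form. *)
Lemma smooth_comp_linear (W V : normedModType R) (l : {linear W -> U})
  (f : U -> V) : continuous l -> smooth f -> smooth (fun y => f (l y)).
Proof.
move=> cl sf k; move: (sf k) => {sf}; elim: k f => [|k IH] f.
  by move=> cf y; apply: (@continuous_comp _ _ _ l f); [exact: cl | exact: cf].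
move=> [df Df].
have dl y : differentiable l y by exact: linear_differentiable.
have dfl y : differentiable (f \o l) y by exact: differentiable_comp.
split=> [y|v]; first exact: dfl.
have -> : (fun y : W => 'D_v (fun z => f (l z)) y) = (fun y => 'D_(l v) f (l y)).
  apply/funext => y; rewrite (deriveE v (dfl y)) (deriveE (l v) (df (l y))).
  by rewrite diff_comp//= diff_lin.
by apply: (IH (fun x => 'D_(l v) f x)); exact: Df.
Qed.

End SmoothCalculus.

Lemma smooth_coord (R : realType) m n (i : 'I_m) (j : 'I_n) :
  smooth (fun M : 'M[R]_(m, n) => M i j).
Proof.
have lin : linear (fun M : 'M[R]_(m, n) => M i j : R).
  by move=> a M N; rewrite !mxE.
pose lM := GRing.isLinear.Build _ _ _ _ _ lin.
pose l : {linear _ -> _} := HB.pack (fun M : 'M[R]_(m, n) => M i j : R) lM.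
apply: (@smooth_linear _ _ _ l) => M; exact: coord_continuous.
Qed.

Lemma smooth_fst_coord (R : realType) m n (i : 'I_m) (j : 'I_n) :
  smooth (fun y : 'M[R]_(m, n) * R => y.1 i j).
Proof.
apply: (@smooth_comp_linear _ _ _ _ fst (fun M : 'M[R]_(m, n) => M i j)).
  by move=> y; exact: cvg_fst.
exact: smooth_coord.
Qed.

(** * Grid linkages *)

Section LightCoordinates.
Variable R : realType.
Implicit Types p q : mink R.

Definition lightA p : R := p 0 0 + p 0 1.
Definition lightB p : R := p 0 0 - p 0 1.
Definition light_point (a b : R) : mink R :=
  \row_(c < 2) if c == 0 then (a + b) / 2 else (a - b) / 2.

Lemma lightA_point a b : lightA (light_point a b) = a.
Proof. by rewrite /lightA !mxE/=; field. Qed.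

Lemma lightB_point a b : lightB (light_point a b) = b.
Proof. by rewrite /lightB !mxE/=; field. Qed.

Lemma light_pointK p : light_point (lightA p) (lightB p) = p.
Proof.
apply/rowP => c; rewrite !mxE /lightA /lightB.
case: c => -[|[|//]] i /=.
  by rewrite (_ : Ordinal i = 0); [field | exact/val_inj].
by rewrite (_ : Ordinal i = 1); [field | exact/val_inj].
Qed.

(** The length whose square is [s]. *)
Definition mink_length (s : R) : R[i] :=
  if 0 <= s then (Num.sqrt s)%:C%C else ((Num.sqrt (- s))*i)%C.

Lemma mink_length_inj : injective mink_length.
Proof.
move=> s t; rewrite /mink_length.
case: (leP 0 s) => [s0|s0]; case: (leP 0 t) => [t0|t0] [] //.
- by move/eqP; rewrite eqr_sqrt// => /eqP.
- by move=> _ /esym/eqP; rewrite sqrtr_eq0 oppr_le0 leNgt t0.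
- by move=> _ /eqP; rewrite sqrtr_eq0 oppr_le0 leNgt s0.
- by move/eqP; rewrite eqr_sqrt ?oppr_ge0 ?ltW// => /eqP/oppr_inj.
Qed.

Lemma is_length_mink_length s : is_length (mink_length s).
Proof.
rewrite /mink_length; case: ifP => _; [left; exists (Num.sqrt s)|
  right; exists (Num.sqrt (- s))] => //; exact: sqrtr_ge0.
Qed.

Lemma deltaE p q :
  delta p q =
  mink_length ((lightA q - lightA p) * (lightB q - lightB p)).
Proof.
rewrite -[LHS]/(mink_length ((q 0 0 - p 0 0) ^+ 2 - (q 0 1 - p 0 1) ^+ 2)).
by congr mink_length; rewrite /lightA /lightB; ring.
Qed.

End LightCoordinates.

Section Grid.
Variables (R : realType) (A B : finType) (a0 a1 : A) (b0 b1 : B).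
Hypotheses (a01 : a0 != a1) (b01 : b0 != b1).

(** A bar [((i, j), (i', j'), c)] is an edge of squared length [c] between the
    vertices [(i, j)] and [(i', j')] of the grid. *)
Definition bar := ((A * B) * (A * B) * R)%type.

Definition bar_holds (al : A -> R) (be : B -> R) (c : bar) : Prop :=
  (al c.1.1.1 - al c.1.2.1) * (be c.1.1.2 - be c.1.2.2) = c.2.

(** A bar between vertices that share a wire coincides with a null edge of the
    grid, hence cannot have nonzero length. *)
Definition bar_ok (c : bar) : bool :=
  (c.1.1.1 != c.1.2.1) && (c.1.1.2 != c.1.2.2) || (c.2 == 0).

Definition wiring (cs : seq bar) (al : A -> R) (be : B -> R) : Prop :=
  [/\ al a0 = 0 /\ al a1 = 1, be b0 = 0 /\ be b1 = 1 &
      forall c, c \in cs -> bar_holds al be c].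

Variable cs : seq bar.
Hypothesis cs_ok : all bar_ok cs.

(** There is one copy of the grid for each bar, plus one, so that the same pair
    of wires may carry several bars without any conflict of lengths, and so that
    the linkage is nonempty even without bars. All copies of a vertex share both
    wires, hence are forced to the same position. *)
Definition grid_vertex : finType := (A * B * 'I_(size cs).+1)%type.
Implicit Types u v : grid_vertex.

(** The default value is the trivial bar, from a vertex to itself. *)
Definition bar_at (k : 'I_(size cs).+1) : bar := nth ((a0, b0), (a0, b0), 0) cs k.

Definition aligned u v := (u.1.1 == v.1.1) || (u.1.2 == v.1.2).

Definition barred u v :=
  (u.2 == v.2) && (((bar_at u.2).1 == (u.1, v.1)) || ((bar_at u.2).1 == (v.1, u.1))).

Definition grid_edge : rel grid_vertex :=
  fun u v => (u != v) && (aligned u v || barred u v).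

Definition grid_len u v : R[i] :=
  mink_length (if aligned u v then 0 else (bar_at u.2).2).

Lemma aligned_sym u v : aligned u v = aligned v u.
Proof. by rewrite /aligned (eq_sym u.1.1) (eq_sym u.1.2). Qed.

Lemma grid_edge_sym : symmetric grid_edge.
Proof.
move=> u v; rewrite /grid_edge eq_sym aligned_sym /barred (eq_sym u.2).
by case: (v.2 =P u.2) => [->|//]; congr (_ && (_ || (_ && _))); exact: orbC.
Qed.

Lemma grid_edge_irr : irreflexive grid_edge.
Proof. by move=> u; rewrite /grid_edge eqxx. Qed.

Lemma aligned_connect u v : aligned u v -> connect grid_edge u v.
Proof.
move=> uv; have [->|nuv] := eqVneq u v; first exact: connect0.
by apply: connect1; rewrite /grid_edge nuv uv.
Qed.

Lemma grid_edge_conn u v : connect grid_edge u v.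
Proof.
apply: (@connect_trans _ _ ((u.1.1, v.1.2), v.2)); apply: aligned_connect.
  by rewrite /aligned /= eqxx.
by rewrite /aligned /= eqxx orbT.
Qed.

Lemma grid_len_sym u v : grid_edge u v -> grid_len u v = grid_len v u.
Proof.
case/andP=> _; rewrite /grid_len (aligned_sym v).
by case: (aligned u v) => //= /andP[/eqP-> _].
Qed.

Definition grid_fixed : {set grid_vertex} :=
  [set v | (v.1.1 \in [:: a0; a1]) && (v.1.2 \in [:: b0; b1])].

Lemma grid_fixed_neq0 : exists v, v \in grid_fixed.
Proof. by exists ((a0, b0), ord0); rewrite !inE !eqxx. Qed.

Definition grid_linkage : linkage R :=
  Linkage grid_edge_sym grid_edge_irr grid_edge_conn grid_len_sym
    (fun u v _ => is_length_mink_length _) grid_fixed_neq0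
    (fun v => light_point (v.1.1 == a1)%:R (v.1.2 == b1)%:R).

Definition grid_conf (al : A -> R) (be : B -> R) : mink_pow R #|grid_vertex| :=
  \matrix_r light_point (al (enum_val r).1.1) (be (enum_val r).1.2).

Lemma pos_grid_conf al be v :
  pos (grid_conf al be) v = light_point (al v.1.1) (be v.1.2).
Proof. by rewrite /pos rowK enum_rankK. Qed.

Lemma pos_inj (phi psi : mink_pow R #|grid_vertex|) :
  (forall v, pos phi v = pos psi v) -> phi = psi.
Proof.
move=> e; apply/row_matrixP => r.
by have := e (enum_val r); rewrite /pos enum_valK.
Qed.

(** The four vertices on constant wires are fixed at the corners of a unit
    square. A vertex on a constant B-wire is null to two fixed vertices with the
    same [b] and distinct [a], which forces its [b]; symmetrically for [a].
    Then the vertices [(i, b0)] and [(i, b1)], null to each other with distinct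
    [b], share their [a], and any vertex [(i, j)] null to both has this [a]. *)
Lemma grid_Conf (phi : mink_pow R #|grid_vertex|) :
  Conf grid_linkage phi <->
  exists al be, wiring cs al be /\ phi = grid_conf al be.
Proof.
split=> [[fixP edgeP]|[al [be [[[al0 al1] [be0 be1] csP] ->]]]]; last first.
  split=> [v|u v] /=.
    rewrite inE pos_grid_conf => /andP[].
    by rewrite !inE => /orP[] /eqP-> /orP[] /eqP->;
      rewrite ?eqxx ?(negPf a01) ?(negPf b01) ?al0 ?al1 ?be0 ?be1.
  move=> /andP[_ uv]; rewrite !pos_grid_conf deltaE !lightA_point !lightB_point.
  rewrite /grid_len; congr mink_length; case: ifP uv => [+ _|_ /= /andP[/eqP uv]].
    by case/orP=> /eqP->; rewrite subrr ?mul0r ?mulr0.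
  have holds_at k : bar_holds al be (bar_at k).
    rewrite /bar_at; have [ks|ks] := ltnP k (size cs); first exact/csP/mem_nth.
    by rewrite nth_default// /bar_holds /= subrr mul0r.
  have := holds_at u.2; rewrite /bar_holds => + /orP[] /eqP E; rewrite E /= => <-//.
  by ring.
pose a v := lightA (pos phi v); pose b v := lightB (pos phi v).
have null u v : aligned u v -> (a v - a u) * (b v - b u) = 0.
  move=> uv; have [->|nuv] := eqVneq u v; first by rewrite subrr mul0r.
  have /= := edgeP u v; rewrite /grid_edge nuv uv => /(_ isT).
  by rewrite deltaE /grid_len uv => /mink_length_inj.
have fixab i j k : i \in [:: a0; a1] -> j \in [:: b0; b1] ->
    a (i, j, k) = (i == a1)%:R /\ b (i, j, k) = (j == b1)%:R.
  move=> hi hj; have /= := fixP (i, j, k); rewrite inE /= hi hj => /(_ isT) E.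
  by rewrite /a /b E lightA_point lightB_point.
have a01' := negPf a01; have b01' := negPf b01.
have ma0 : a0 \in [:: a0; a1] by rewrite !inE eqxx.
have ma1 : a1 \in [:: a0; a1] by rewrite !inE eqxx orbT.
have mb0 : b0 \in [:: b0; b1] by rewrite !inE eqxx.
have mb1 : b1 \in [:: b0; b1] by rewrite !inE eqxx orbT.
have bi i j k : j \in [:: b0; b1] -> b (i, j, k) = (j == b1)%:R.
  move=> hj; have := null (a0, j, ord0) (i, j, k); have := null (a1, j, ord0) (i, j, k).
  rewrite /aligned /= eqxx !orbT => /(_ isT) h1 /(_ isT) h0.
  have [E0 F0] := fixab a0 j ord0 ma0 hj; have [E1 F1] := fixab a1 j ord0 ma1 hj.
  move: h0 h1; rewrite E0 F0 E1 F1 eqxx a01' /= => h0 h1.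
  by nra.
have aj i j k : i \in [:: a0; a1] -> a (i, j, k) = (i == a1)%:R.
  move=> hi; have := null (i, b0, ord0) (i, j, k); have := null (i, b1, ord0) (i, j, k).
  rewrite /aligned /= eqxx => /(_ isT) h1 /(_ isT) h0.
  have [E0 F0] := fixab i b0 ord0 hi mb0; have [E1 F1] := fixab i b1 ord0 hi mb1.
  move: h0 h1; rewrite E0 F0 E1 F1 eqxx b01' /= => h0 h1.
  by nra.
have aE i j j' k k' : a (i, j, k) = a (i, j', k').
  suff main j1 k1 : a (i, j1, k1) = a (i, b0, ord0) by rewrite !main.
  have h := null (i, b0, ord0) (i, b1, ord0).
  have h0 := null (i, b0, ord0) (i, j1, k1).
  have h1 := null (i, b1, ord0) (i, j1, k1).
  move: h h0 h1; rewrite /aligned /= eqxx => /(_ isT) h /(_ isT) h0 /(_ isT) h1.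
  have E0 := bi i b0 ord0 mb0; have E1 := bi i b1 ord0 mb1.
  move: h h0 h1; rewrite E0 E1 eqxx b01' /= => h h0 h1.
  nra.
have bE i i' j k k' : b (i, j, k) = b (i', j, k').
  suff main i1 k1 : b (i1, j, k1) = b (a0, j, ord0) by rewrite !main.
  have h := null (a0, j, ord0) (a1, j, ord0).
  have h0 := null (a0, j, ord0) (i1, j, k1).
  have h1 := null (a1, j, ord0) (i1, j, k1).
  move: h h0 h1; rewrite /aligned /= eqxx !orbT => /(_ isT) h /(_ isT) h0 /(_ isT) h1.
  have E0 := aj a0 j ord0 ma0; have E1 := aj a1 j ord0 ma1.
  move: h h0 h1; rewrite E0 E1 eqxx a01' /= => h h0 h1.
  nra.
exists (fun i => a (i, b0, ord0)), (fun j => b (a0, j, ord0)); split; last first.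
  apply: pos_inj => -[[i j] k]; rewrite pos_grid_conf /=.
  by rewrite (aE i b0 j ord0 k) (bE a0 i j ord0 k) light_pointK.
split; [| |move=> c c_cs].
- by rewrite !aj// eqxx a01'.
- by rewrite !bi// eqxx b01'.
have c_lt : (index c cs < (size cs).+1)%N by rewrite ltnS index_size.
pose k := Ordinal c_lt; have ck : bar_at k = c by rewrite /bar_at nth_index.
rewrite /bar_holds.
have -> : a (c.1.1.1, b0, ord0) = a (c.1.1.1, c.1.1.2, k) by exact: aE.
have -> : a (c.1.2.1, b0, ord0) = a (c.1.2.1, c.1.2.2, k) by exact: aE.
have -> : b (a0, c.1.1.2, ord0) = b (c.1.1.1, c.1.1.2, k) by exact: bE.
have -> : b (a0, c.1.2.2, ord0) = b (c.1.2.1, c.1.2.2, k) by exact: bE.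
set u := (c.1.1.1, c.1.1.2, k); set v := (c.1.2.1, c.1.2.2, k).
have -> : (a u - a v) * (b u - b v) = (a v - a u) * (b v - b u) by ring.
have [uv|nuv] := boolP (aligned u v).
  rewrite null//; have := allP cs_ok c c_cs.
  by case/orP=> [/andP[]|/eqP->//]; move: uv; rewrite /aligned /= => /orP[] ->.
have /= := edgeP u v; rewrite /grid_edge (negPf nuv) /= /barred /= ck.
have -> : c.1 == (u.1, v.1) by rewrite /u /v /=; case: (c) => -[[? ?] [? ?]] ?.
have -> /= : u != v by apply: contraNN nuv => /eqP->; rewrite /aligned eqxx.
rewrite eqxx => /(_ isT).
by rewrite deltaE /grid_len (negPf nuv) /= ck => /mink_length_inj.
Qed.
End Grid.

(** * The arithmetic gate *)

Section Gate.
Variable R : realType.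

Definition sgn (b : bool) : R := if b then 1 else -1.

Lemma sgn_sqr b : sgn b ^+ 2 = 1.
Proof. by case: b; rewrite /sgn ?sqrrN expr1n. Qed.

(** With [x = 1 / (1 - rho) - 1 / rho] and 0 < rho < 1, the number
    [2 + hyp x] is [s = 1 / (1 - rho) + 1 / rho], because
    [(s - 2) ^ 2 = x ^ 2 + 4] and [s >= 4]. *)
Definition hyp (x : R) : R := Num.sqrt (x ^+ 2 + 4).

Lemma hyp_sqr x : hyp x ^+ 2 = x ^+ 2 + 4.
Proof. by rewrite sqr_sqrtr// addr_ge0// sqr_ge0. Qed.

Lemma hyp_gt0 x : 0 < hyp x.
Proof. by rewrite sqrtr_gt0 ltr_wpDl// sqr_ge0. Qed.

Lemma hyp_gt_norm x : `|x| < hyp x.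
Proof. by rewrite -sqrtr_sqr ltr_sqrt ?ltrDl// ltr_wpDl// sqr_ge0. Qed.

Definition gate_root (x : R) : R := Num.sqrt (2 + hyp x).

Lemma gate_root_gt0 x : 0 < gate_root x.
Proof. by rewrite sqrtr_gt0 addr_gt0// hyp_gt0. Qed.

Lemma gate_root_sqr x : gate_root x ^+ 2 = 2 + hyp x.
Proof. by rewrite sqr_sqrtr// addr_ge0// ltW// hyp_gt0. Qed.

(** The values forced on the A-wires of a gate with inputs [x], [y] and sign
    [e], in this order: [1 / (1 - rho)], [s], [sg], three partial sums of the
    output, and [1 / rho]. *)
Definition gateA (x y lam mu e : R) : seq R :=
  let s := 2 + hyp x in let Q := (s - x) / 2 in
  [:: (s + x) / 2; s; (1 + e * gate_root x) / 2;
      y - lam * Q; y + lam * x; y + lam * x + mu * (s ^+ 2 - s); Q].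

(** The values forced on the B-wires of a gate: [rho], [1 / (s - 1)], [1 / s],
    [tau], [1 / (1 - rho) - 1], and a copy of [x]. *)
Definition gateB (x e : R) : seq R :=
  let s := 2 + hyp x in
  [:: ((s - x) / 2)^-1; (s - 1)^-1; s^-1;
      (1 - e * gate_root x) / 2 * (s - 1)^-1; (s + x) / 2 - 1; x].

(** The first three equations say [q = 1 / (1 - rho)], [x = q - 1 / rho] and
    [s = q + 1 / rho]. The sixth and seventh eliminate [tau] and leave
    [sg * (sg - 1) = (s - 1) / 4], that is [s = (2 sg - 1) ^ 2]: so [s] is
    nonnegative, which selects the branch 0 < rho < 1. The output is then
    summed term by term: [lam * x] as [lam * q - lam / rho], and [mu * x ^ 2] as
    [mu * (s ^ 2 - s) - 3 * mu * s] because [x ^ 2 = s ^ 2 - 4 s], where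
    [s ^ 2 - s] is the inverse of [1 / (s - 1) - 1 / s]. *)
Lemma gate_solve (x y out lam mu q s sg t1 t2 t3 Q rho d c tau P X : R) :
    q * (rho - 1) = -1 -> (x - q) * rho = -1 ->
    (s - q) * rho = 1 -> (s - 1) * d = 1 -> s * c = 1 ->
    sg * tau = - 4^-1 -> (sg - 1) * (tau - d) = - 4^-1 ->
    (t1 - y) * rho = - lam -> (t2 - t1) * (rho - 1) = - lam ->
    (t3 - t2) * (d - c) = mu -> (out - t3) * c = - (3 * mu) ->
    Q * rho = 1 -> (Q - 1) * P = 1 -> (q - 1) * (X - P) = -1 ->
  exists e : bool,
    [/\ out = y + lam * x + mu * x ^+ 2,
       [:: q; s; sg; t1; t2; t3; Q] = gateA x y lam mu (sgn e) &
       [:: rho; d; c; tau; P; X] = gateB x (sgn e)].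
Proof.
move=> E1 E2 E3 E4 E5 E6 E7 E8 E9 E10 E11 E12 E13 E14.
have factor_neq0 (u v : R) : u * v = 1 -> u != 0.
  by move=> uv; apply: contra_eq_neq uv => ->; rewrite mul0r eq_sym oner_neq0.
have Q0 : Q != 0 by exact: factor_neq0 E12.
have rho0 : rho != 0 by apply: (factor_neq0 _ Q); rewrite mulrC.
have rhoE : rho = Q^-1 by apply: (mulfI Q0); rewrite E12 divff.
have xE : x = q - Q by apply: (mulIf rho0); rewrite mulrBl E12 -E2; ring.
have sE : s = q + Q.
  by apply: (mulIf rho0); rewrite mulrDl E12 -E3; ring.
(* 1 / (rho (1 - rho)) = 1 / rho + 1 / (1 - rho) *)
have qQ : q * Q = s.
  have : q * (rho - 1) * Q = - Q by rewrite E1 mulN1r.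
  by rewrite -mulrA mulrBl (mulrC rho) E12 sE => h; lra.
(* The equation that excludes the solution rho outside [0, 1]. *)
have sgE : s = (2 * sg - 1) ^+ 2.
  have h : tau = d * (1 - sg) by move: E6 E7 => h6 h7; lra.
  have h' : (s - 1) * (sg * tau) = - (s - 1) / 4 by rewrite E6; ring.
  have h'' : (s - 1) * (sg * tau) = ((s - 1) * d) * (sg * (1 - sg)) by rewrite h; ring.
  move: h'; rewrite h'' E4 => h'; lra.
have s0 : s != 0 by exact: factor_neq0 E5.
have s_gt0 : 0 < s by rewrite lt_neqAle eq_sym s0 sgE sqr_ge0.
have s2 : (s - 2) ^+ 2 = x ^+ 2 + 4 by rewrite xE sE; rewrite sE in qQ; lra.
have s4 : 0 <= s - 2.
  have : 0 <= s * (s - 4) by have := sqr_ge0 x; lra.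
  by rewrite pmulr_rge0// => h; lra.
have sr : s = 2 + hyp x by rewrite /hyp -s2 sqrtr_sqr ger0_norm//; ring.
have QE : Q = (s - x) / 2 by rewrite xE sE; field.
have qE : q = (s + x) / 2 by rewrite xE sE; field.
have dE : d = (s - 1)^-1 by rewrite (mulr1_eq E4).
have cE : c = s^-1 by rewrite (mulr1_eq E5).
have tauE : tau = (1 - sg) * d by move: E6 E7 => h6 h7; lra.
have t1E : t1 = y - lam * Q.
  have h : (t1 - y) * (Q * rho) = - lam * Q by rewrite -E8; ring.
  by move: h; rewrite E12; lra.
have t2E : t2 = y + lam * x.
  have h : (t2 - t1) * (q * (rho - 1)) = - lam * q by rewrite -E9; ring.
  by move: h; rewrite E1 t1E xE; lra.
have t3E : t3 = y + lam * x + mu * (s ^+ 2 - s).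
  have h : (t3 - t2) * (s * ((s - 1) * d) - (s - 1) * (s * c)) = mu * (s * (s - 1)).
    by rewrite -E10; ring.
  by move: h; rewrite E4 E5 t2E => h; lra.
have outE : out = y + lam * x + mu * x ^+ 2.
  have h : (out - t3) * (s * c) = - (3 * mu) * s by rewrite -E11; ring.
  have -> : x ^+ 2 = s ^+ 2 - 4 * s by lra.
  by move: h; rewrite E5 t3E => h; lra.
have PE : P = q - 1.
  by rewrite -(mulr1_eq E13); apply: mulr1_eq; rewrite sE in qQ; lra.
(* (Q - 1) (q - 1) = 1, so 1 / (q - 1) = Q - 1 = 1 / rho - 1. *)
have XE : X = x.
  have h : ((Q - 1) * (q - 1)) * (X - P) = - (Q - 1) by rewrite -mulrA E14; ring.
  have h1 : (Q - 1) * (q - 1) = 1 by rewrite sE in qQ; lra.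
  by move: h; rewrite h1 PE xE; lra.
have [e eE] : exists e : bool, 2 * sg - 1 = sgn e * gate_root x.
  have : (2 * sg - 1) ^+ 2 == gate_root x ^+ 2 by rewrite gate_root_sqr -sr sgE.
  rewrite eqf_sqr => /orP[] /eqP->; [exists true | exists false]; rewrite /sgn; ring.
have sg2 : sg = (1 + sgn e * gate_root x) / 2 by lra.
exists e; split=> //.
  by rewrite /gateA /= -sr -qE -QE -sg2 -t1E -t3E -t2E.
rewrite /gateB /= -sr -QE -qE -rhoE -dE -cE -PE XE tauE.
by congr [:: _; _; _; _ * _; _; _]; rewrite sg2; field.
Qed.

(** Conversely the forced values satisfy all the equations, for every real [x]
    and both signs: no denominator vanishes because [s >= 4] and [|x| < hyp x]. *)
Lemma gate_check (x y lam mu : R) (b : bool) :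
  let s := 2 + hyp x in let Q := (s - x) / 2 in let q := (s + x) / 2 in
  let sg := (1 + sgn b * gate_root x) / 2 in
  let rho := Q^-1 in let d := (s - 1)^-1 in let c := s^-1 in
  let tau := (1 - sgn b * gate_root x) / 2 * d in let P := q - 1 in
  let t1 := y - lam * Q in let t2 := y + lam * x in
  let t3 := y + lam * x + mu * (s ^+ 2 - s) in
  let out := y + lam * x + mu * x ^+ 2 in
  [/\ [/\ q * (rho - 1) = -1, (x - q) * rho = -1,
    (s - q) * rho = 1, (s - 1) * d = 1 & s * c = 1],
   [/\ sg * tau = - 4^-1 & (sg - 1) * (tau - d) = - 4^-1],
   [/\ (t1 - y) * rho = - lam, (t2 - t1) * (rho - 1) = - lam,
       (t3 - t2) * (d - c) = mu & (out - t3) * c = - (3 * mu)] &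
   [/\ Q * rho = 1, (Q - 1) * P = 1 & (q - 1) * (x - P) = -1]].
Proof.
move=> s Q q sg rho d c tau P t1 t2 t3 out.
have := hyp_gt0 x => r0.
have := hyp_gt_norm x; rewrite ltr_norml => /andP[xr1 xr2].
have Q_gt0 : 0 < Q by rewrite /Q /s; lra.
have s1_gt0 : 0 < s - 1 by rewrite /s; lra.
have s_gt0 : 0 < s by rewrite /s; lra.
have Q0 : Q != 0 by rewrite gt_eqF.
have s10 : s - 1 != 0 by rewrite gt_eqF.
have s0 : s != 0 by rewrite gt_eqF.
have sE : s = q + Q by rewrite /q /Q; field.
have xE : x = q - Q by rewrite /q /Q; field.
have qQ : q * Q = s by have := hyp_sqr x; rewrite /q /Q /s => h; lra.
have Qr : Q * rho = 1 by rewrite divff.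
have s1d : (s - 1) * d = 1 by rewrite divff.
have sc : s * c = 1 by rewrite divff.
have qrho : q * rho = q - 1.
  have : q * (Q * rho) = (q * Q) * rho by ring.
  by rewrite Qr qQ sE mulrDl Qr => h; lra.
have x2 : x ^+ 2 = s ^+ 2 - 4 * s by have := hyp_sqr x; rewrite /s => h; lra.
have w2 : (1 + sgn b * gate_root x) * (1 - sgn b * gate_root x) = 1 - s.
  transitivity (1 - sgn b ^+ 2 * gate_root x ^+ 2); first by ring.
  by rewrite sgn_sqr gate_root_sqr mul1r.
split; split=> //.
- by lra.
- by transitivity (- (Q * rho)); [rewrite {1}xE; ring | rewrite Qr].
- by transitivity (Q * rho); [rewrite {1}sE; ring | exact: Qr].
- transitivity ((1 + sgn b * gate_root x) * (1 - sgn b * gate_root x) * d / 4).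
    by rewrite /sg /tau; field.
  by rewrite w2; lra.
- transitivity ((1 + sgn b * gate_root x) * (1 - sgn b * gate_root x) * d / 4).
    by rewrite /sg /tau; field.
  by rewrite w2; lra.
- by transitivity (- lam * (Q * rho)); [rewrite /t1; ring | rewrite Qr mulr1].
- transitivity (lam * (q * rho - q)); first by rewrite /t1 /t2 xE; ring.
  by rewrite qrho; ring.
- transitivity (mu * (s * ((s - 1) * d) - (s - 1) * (s * c))).
    by rewrite /t3 /t2; ring.
  by rewrite s1d sc; ring.
- rewrite /out /t3 x2; transitivity (- 3 * mu * (s * c)); first by ring.
  by rewrite sc; ring.
- by rewrite /P mulrBr mulrBl mulrC -/q qQ sE; ring.
- transitivity (- ((Q - 1) * P)); first by rewrite /P {1}xE; ring.
  by congr (- _); rewrite /P mulrBr mulrBl mulrC -/q qQ sE; ring.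
Qed.

Lemma forall_ord_lt n (P : 'I_n -> Prop) :
  (forall i (h : (i < n)%N), P (Ordinal h)) -> forall i, P i.
Proof. by move=> h [i hi]. Qed.

Section Bars.
Variables (A B : finType) (a0 a1 x y out : A) (b0 b1 : B).
Variables (wa : 'I_7 -> A) (wb : 'I_6 -> B) (lam mu : R).

Local Notation a_ n := (wa (@Ordinal 7 n isT)).
Local Notation b_ n := (wb (@Ordinal 6 n isT)).

(** The bars are listed in the order of the equations of [gate_solve]. *)
Definition gate_bars : seq (bar R A B) :=
  let q := a_ 0 in let s := a_ 1 in let sg := a_ 2 in
  let t1 := a_ 3 in let t2 := a_ 4 in let t3 := a_ 5 in let Q := a_ 6 in
  let rho := b_ 0 in let d := b_ 1 in let c := b_ 2 in
  let tau := b_ 3 in let P := b_ 4 in let X := b_ 5 in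
  [:: ((q, rho), (a0, b1), -1); ((x, rho), (q, b0), -1);
      ((s, rho), (q, b0), 1); ((s, d), (a1, b0), 1); ((s, c), (a0, b0), 1);
      ((sg, tau), (a0, b0), - 4^-1); ((sg, tau), (a1, d), - 4^-1);
      ((t1, rho), (y, b0), - lam); ((t2, rho), (t1, b1), - lam);
      ((t3, d), (t2, c), mu); ((out, c), (t3, b0), - (3 * mu));
      ((Q, rho), (a0, b0), 1); ((Q, P), (a1, b0), 1); ((q, X), (a1, P), -1)].

Variables (al : A -> R) (be : B -> R).
Hypotheses (al0 : al a0 = 0) (al1 : al a1 = 1) (be0 : be b0 = 0) (be1 : be b1 = 1).

Lemma gate_barsP :
  (forall c, c \in gate_bars -> bar_holds al be c) <->
  al out = al y + lam * al x + mu * al x ^+ 2 /\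
  exists e : bool,
    (forall i, al (wa i) = nth 0 (gateA (al x) (al y) lam mu (sgn e)) i) /\
    (forall j, be (wb j) = nth 0 (gateB (al x) (sgn e)) j).
Proof.
split=> [H|[outE [e [waE wbE]]]].
  have {}H : all [pred c : bar R A B | (al c.1.1.1 - al c.1.2.1) *
      (be c.1.1.2 - be c.1.2.2) == c.2] gate_bars.
    by apply/allP => c /H /eqP.
  move: H; rewrite /gate_bars /= al0 al1 be0 be1 !subr0.
  case/and5P=> /eqP E1 /eqP E2 /eqP E3 /eqP E4.
  case/and5P=> /eqP E5 /eqP E6 /eqP E7 /eqP E8.
  case/and5P=> /eqP E9 /eqP E10 /eqP E11 /eqP E12 /and3P[/eqP E13 /eqP E14 _].
  have [e [outE aE bE]] :=
    gate_solve E1 E2 E3 E4 E5 E6 E7 E8 E9 E10 E11 E12 E13 E14.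
  split=> //; exists e; rewrite -aE -bE; split; apply: forall_ord_lt => i h.
    by do 7?[case: i h => [|i] h; first by congr (al (wa _)); exact: val_inj].
  by do 6?[case: i h => [|i] h; first by congr (be (wb _)); exact: val_inj].
have [[E1 E2 E3 E4 E5] [E6 E7] [E8 E9 E10 E11] [E12 E13 E14]] :=
  gate_check (al x) (al y) lam mu e.
suff /allP H : all [pred c : bar R A B | (al c.1.1.1 - al c.1.2.1) *
    (be c.1.1.2 - be c.1.2.2) == c.2] gate_bars by move=> c /H /eqP.
rewrite /gate_bars /= !waE !wbE al0 al1 be0 be1 outE !subr0 /=.
rewrite E1 E2 E3 E4 E5 E6 E7 E8 E9 E10 E11 E12 E13 E14.
by rewrite !eqxx.
Qed.
End Bars.
End Gate.

Lemma gate_bars_ok (R : realType) (A B : finType) (a0 a1 x y out : A) (b0 b1 : B)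
    (wa : 'I_7 -> A) (wb : 'I_6 -> B) (lam mu : R) :
  injective wa -> injective wb ->
  (forall i, wa i \notin [:: a0; a1; x; y; out]) ->
  (forall j, wb j \notin [:: b0; b1]) ->
  all (@bar_ok R A B) (gate_bars a0 a1 x y out b0 b1 wa wb lam mu).
Proof.
move=> injA injB waN wbN.
have wa0 i : (wa i == a0) = false by have := waN i; rewrite inE => /norP[/negPf].
have wa1 i : (wa i == a1) = false.
  by have := waN i; rewrite !inE !negb_or => /and5P[_ /negPf].
have wax i : (x == wa i) = false.
  by have := waN i; rewrite !inE !negb_or (eq_sym x) => /and5P[_ _ /negPf].
have way i : (wa i == y) = false.
  by have := waN i; rewrite !inE !negb_or => /and5P[_ _ _ /negPf].
have wao i : (out == wa i) = false.
  by have := waN i; rewrite !inE !negb_or (eq_sym out) => /and5P[_ _ _ _ /negPf].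
have wb0 j : (wb j == b0) = false by have := wbN j; rewrite inE => /norP[/negPf].
have wb1 j : (wb j == b1) = false.
  by have := wbN j; rewrite !inE !negb_or => /andP[_ /negPf].
have waE i j : (wa i == wa j) = (i == j) by exact: inj_eq.
have wbE i j : (wb i == wb j) = (i == j) by exact: inj_eq.
by rewrite /gate_bars /= /bar_ok /= !waE !wbE !wa0 !wa1 !wax !way !wao !wb0 !wb1.
Qed.

Section GateSmooth.
Variables (R : realType) (U : normedModType R) (x y e : U -> R) (lam mu : R).
Hypotheses (sx : smooth x) (sy : smooth y) (se : smooth e).

Lemma smooth_hyp : smooth (fun u => hyp (x u)).
Proof.
apply: smooth_sqrt => [u|]; first by rewrite ltr_wpDl// sqr_ge0.
by apply: smoothD; [exact: smoothX | exact: smooth_cst].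
Qed.

Lemma smooth_gate_root : smooth (fun u => gate_root (x u)).
Proof.
apply: smooth_sqrt => [u|]; first by rewrite addr_gt0// hyp_gt0.
by apply: smoothD; [exact: smooth_cst | exact: smooth_hyp].
Qed.

Let ss : smooth (fun u => 2 + hyp (x u)).
Proof. by apply: smoothD; [exact: smooth_cst | exact: smooth_hyp]. Qed.

Let sQ : smooth (fun u => (2 + hyp (x u) - x u) / 2).
Proof. by apply: smoothM; [exact: smoothB | exact: smooth_cst]. Qed.

Let sq : smooth (fun u => (2 + hyp (x u) + x u) / 2).
Proof. by apply: smoothM; [exact: smoothD | exact: smooth_cst]. Qed.

Let sy2 : smooth (fun u => y u + lam * x u).
Proof.
by apply: smoothD => //; apply: smoothM => //; exact: smooth_cst.
Qed.

Lemma smooth_gateA i : smooth (fun u => (gateA (x u) (y u) lam mu (e u))`_i).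
Proof.
case: i => [|[|[|[|[|[|[|i]]]]]]] /=; [exact: sq | exact: ss | | | exact: sy2 | |
  exact: sQ | by case: i => [|i]; exact: smooth_cst].
- apply: smoothM; last exact: smooth_cst.
  apply: smoothD; first exact: smooth_cst.
  by apply: smoothM => //; exact: smooth_gate_root.
- by apply: smoothB => //; apply: smoothM => //; exact: smooth_cst.
- apply: smoothD => //; apply: smoothM; first exact: smooth_cst.
  by apply: smoothB => //; exact: smoothX.
Qed.

Let sd : smooth (fun u => (2 + hyp (x u) - 1)^-1).
Proof.
apply: smoothV => [u|].
  by rewrite gt_eqF//; have := hyp_gt0 (x u); lra.
by apply: smoothB => //; exact: smooth_cst.
Qed.

Lemma smooth_gateB i : smooth (fun u => (gateB (x u) (e u))`_i).
Proof.
case: i => [|[|[|[|[|[|i]]]]]] /=; [ | exact: sd | | | | by [] |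
  by case: i => [|i]; exact: smooth_cst].
- apply: smoothV => // u; rewrite gt_eqF//.
  have := hyp_gt_norm (x u); rewrite ltr_norml => /andP[_ ?].
  by rewrite divr_gt0//; lra.
- by apply: smoothV => // u; rewrite gt_eqF//; have := hyp_gt0 (x u); lra.
- apply: smoothM; last exact: sd.
  apply: smoothM; last exact: smooth_cst.
  apply: smoothB; first exact: smooth_cst.
  by apply: smoothM => //; exact: smooth_gate_root.
- by apply: smoothB => //; exact: smooth_cst.
Qed.

End GateSmooth.

(** * Straight-line programs *)

Section Programs.
Variables (R : realType) (m : nat).

(** The instruction [(ix, iy, lam, mu)] appends a register of value
    [r_iy + lam * r_ix + mu * r_ix ^ 2]. Registers 0 and 1 hold the constants 0
    and 1, and the [m] next ones hold the inputs. *)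
Definition instr := (nat * nat * R * R)%type.

Definition instr_val (rs : seq R) (g : instr) : R :=
  let: (ix, iy, lam, mu) := g in rs`_iy + lam * rs`_ix + mu * rs`_ix ^+ 2.

Definition instr_ok (N : nat) (g : instr) : bool :=
  (g.1.1.1 < N)%N && (g.1.1.2 < N)%N.

Definition run (z : seq R) (p : seq instr) : seq R :=
  foldl (fun rs g => rcons rs (instr_val rs g)) [:: 0, 1 & z] p.

Definition instr0 : instr := (0%N, 0%N, 0, 0).

Definition prog_ok (p : seq instr) : Prop :=
  forall k, (k < size p)%N -> instr_ok (2 + m + k) (nth instr0 p k).

Lemma run_rcons z p g : run z (rcons p g) = rcons (run z p) (instr_val (run z p) g).
Proof. by rewrite /run -cats1 foldl_cat. Qed.

Lemma size_run z p : size z = m -> size (run z p) = (2 + m + size p)%N.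
Proof.
move=> zm; elim/last_ind: p => [|p g IH]; first by rewrite /= zm addn0.
by rewrite run_rcons !size_rcons IH addnS.
Qed.

Lemma run_cat z p p' i : size z = m -> (i < 2 + m + size p)%N ->
  (run z (p ++ p'))`_i = (run z p)`_i.
Proof.
move=> zm ip; elim/last_ind: p' => [|p' g IH]; first by rewrite cats0.
rewrite -rcons_cat run_rcons nth_rcons size_run// size_cat.
by rewrite (leq_trans ip)// leq_add2l leq_addr.
Qed.

Lemma run_input z p i : size z = m -> (i < m)%N -> (run z p)`_(2 + i) = z`_i.
Proof. by move=> zm im; rewrite -[p]cat0s run_cat// addn0 ltn_add2l. Qed.

Lemma run_last z p g : size z = m ->
  (run z (rcons p g))`_(2 + m + size p) = instr_val (run z p) g.
Proof. by move=> zm; rewrite run_rcons nth_rcons size_run// ltnn eqxx. Qed.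

Lemma prog_ok_rcons p g : prog_ok p -> instr_ok (2 + m + size p) g ->
  prog_ok (rcons p g).
Proof.
move=> pok gok k; rewrite size_rcons ltnS nth_rcons => kp.
by case: ltngtP kp => // [kp _| -> _ //]; exact: pok.
Qed.

Lemma run_output z p k : size z = m -> prog_ok p -> (k < size p)%N ->
  (run z p)`_(2 + m + k) = instr_val (run z p) (nth instr0 p k).
Proof.
move=> zm pok kp; rewrite -[in LHS](cat_take_drop k.+1 p).
have sk : size (take k p) = k by rewrite size_takel// ltnW.
rewrite run_cat//; last by rewrite size_takel// ltn_add2l.
rewrite (take_nth instr0 kp).
have := run_last (take k p) (nth instr0 p k) zm; rewrite sk => ->.
have /andP[] := pok k kp; case: (nth _ _ _) => -[[ix iy] lam] mu /= hx hy.
by rewrite -[in RHS](cat_take_drop k p) !run_cat// sk.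
Qed.

(** The equations of a program, imposed simultaneously on arbitrary numbers,
    have its run as their only solution: each instruction refers only to earlier
    registers. *)
Lemma run_unique z p (reg : nat -> R) : size z = m -> prog_ok p ->
    reg 0%N = 0 -> reg 1%N = 1 -> (forall i, (i < m)%N -> reg (2 + i)%N = z`_i) ->
    (forall k, (k < size p)%N ->
      let: (ix, iy, lam, mu) := nth instr0 p k in
      reg (2 + m + k)%N = reg iy + lam * reg ix + mu * reg ix ^+ 2) ->
  forall i, (i < 2 + m + size p)%N -> reg i = (run z p)`_i.
Proof.
move=> zm pok reg0 reg1 regz regp; elim/ltn_ind => i IH ip.
have [i2|i2] := ltnP i 2.
  rewrite -[p]cat0s run_cat ?addn0 ?(leq_trans i2) ?leq_addr//.
  by case: i i2 {IH ip} => [|[|]].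
have [im|im] := ltnP i (2 + m).
  by rewrite -(subnKC i2) run_input ?regz// ltn_subLR.
have kp : (i - (2 + m) < size p)%N by rewrite ltn_subLR.
have := regp _ kp; have := run_output zm pok kp; have := pok _ kp.
rewrite (subnKC im).
case: (nth _ _ _) => -[[ix iy] lam] mu /= /andP[/= hx hy] -> ->.
by rewrite !IH// ?(ltn_trans hx) ?(ltn_trans hy).
Qed.

(** The quantification over the initial program [p] lets computations be
    chained: each one runs after all the previous ones and can use their
    registers. *)
Definition computable (f : seq R -> R) : Prop :=
  forall p, prog_ok p -> exists p' o,
    [/\ prog_ok (p ++ p'), (o < 2 + m + size (p ++ p'))%N &
        forall z, size z = m -> (run z (p ++ p'))`_o = f z].

Lemma computable_step f g lam mu : computable f -> computable g ->
  computable (fun z => g z + lam * f z + mu * f z ^+ 2).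
Proof.
move=> cf cg p /cf [p1 [ o1 [ok1 o1lt h1]]].
have [p2 [ o2 [ok2 o2lt h2]]] := cg _ ok1.
rewrite -catA in ok2 o2lt.
have o1lt' : (o1 < 2 + m + size (p ++ p1 ++ p2))%N.
  by rewrite (leq_trans o1lt)// leq_add2l !size_cat leq_add2l leq_addr.
exists (rcons (p1 ++ p2) (o1, o2, lam, mu)), (2 + m + size (p ++ p1 ++ p2))%N.
rewrite -rcons_cat; split.
- by apply: prog_ok_rcons => //; rewrite /instr_ok /= o1lt' o2lt.
- by rewrite size_rcons ltn_add2l.
- by move=> z zm; rewrite run_last//= catA h2// run_cat// h1.
Qed.

Lemma computable_reg i : (i < 2 + m)%N -> computable (fun z => (run z [::])`_i).
Proof.
move=> im p pok; exists [::], i; rewrite cats0; split=> //.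
  by rewrite (leq_trans im)// leq_addr.
by move=> z zm; rewrite -{1}[p]cat0s run_cat// addn0.
Qed.

Lemma computable_cst c : computable (fun=> c).
Proof.
have c0 := @computable_reg 0%N isT; have c1 := @computable_reg 1%N isT.
have := computable_step c 0 c1 c0; congr computable.
by apply/funext => z /=; ring.
Qed.

Lemma computable_var i : (i < m)%N -> computable (fun z => z`_i).
Proof. by move=> im; apply: (@computable_reg (2 + i)); rewrite ltn_add2l. Qed.

Lemma computableD f g : computable f -> computable g ->
  computable (fun z => f z + g z).
Proof.
move=> cf cg; have := computable_step 1 0 cg cf; congr computable.
by apply/funext => z /=; ring.
Qed.

(** Polarization: [f g = ((f + g) ^ 2 - f ^ 2 - g ^ 2) / 2]. *)
Lemma computableM f g : computable f -> computable g ->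
  computable (fun z => f z * g z).
Proof.
move=> cf cg; have cs := computableD cf cg.
have := computable_step 0 2^-1 cs (computable_step 0 (- 2^-1) cf
  (computable_step 0 (- 2^-1) cg (computable_cst 0))).
by congr computable; apply/funext => z /=; field.
Qed.

Lemma computable_sum (I : Type) (r : seq I) (f : I -> seq R -> R) :
  (forall i, computable (f i)) -> computable (fun z => \sum_(i <- r) f i z).
Proof.
move=> cf; elim: r => [|i r IH].
  by under eq_fun do rewrite big_nil; exact: computable_cst.
by under eq_fun do rewrite big_cons; exact: computableD.
Qed.

Lemma computable_prod (I : Type) (r : seq I) (f : I -> seq R -> R) :
  (forall i, computable (f i)) -> computable (fun z => \prod_(i <- r) f i z).
Proof.
move=> cf; elim: r => [|i r IH].
  by under eq_fun do rewrite big_nil; exact: computable_cst.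
by under eq_fun do rewrite big_cons; exact: computableM.
Qed.

Lemma computableX f k : computable f -> computable (fun z => f z ^+ k).
Proof.
move=> cf; elim: k => [|k IH].
  by under eq_fun do rewrite expr0; exact: computable_cst.
by under eq_fun do rewrite exprS; exact: computableM.
Qed.

Lemma computable_meval k (q : mpoly.mpoly k R) (v : 'I_k -> seq R -> R) :
  (forall i, computable (v i)) -> computable (fun z => mpoly.meval (v^~ z) q).
Proof.
move=> cv; under eq_fun do rewrite mpoly.mevalE.
apply: computable_sum => mm; apply: computableM; first exact: computable_cst.
by apply: computable_prod => i; exact: computableX.
Qed.

Lemma smooth_run (U : normedModType R) (z : U -> seq R) p i :
  (forall x, size (z x) = m) -> (forall j, smooth (fun x => (z x)`_j)) ->
  smooth (fun x => (run (z x) p)`_i).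
Proof.
move=> zm sz; elim/last_ind: p i => [|p [[[ix iy] lam] mu] IH] i.
  by case: i => [|[|i]] /=; [exact: smooth_cst | exact: smooth_cst | exact: sz].
under eq_fun do rewrite run_rcons nth_rcons size_run//.
case: (i < _)%N; first exact: IH.
case: (i == _); last exact: smooth_cst.
rewrite /instr_val /=; apply: smoothD; first (apply: smoothD; first exact: IH).
  by apply: smoothM; [exact: smooth_cst | exact: IH].
by apply: smoothM; [exact: smooth_cst | apply: smoothX; exact: IH].
Qed.

End Programs.

(** * Coverings by sign patterns *)

Lemma interpolation (R : realType) N (v : nat -> R) :
  exists P : {poly R}, forall i, (i < N)%N -> P.[i%:R] = v i.
Proof.
elim: N => [|N [P HP]]; first by exists 0.
pose W : {poly R} := \prod_(j < N) ('X - j%:R%:P).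
have W0 i : (i < N)%N -> W.[i%:R] = 0.
  move=> iN; rewrite horner_prod (bigD1 (Ordinal iN))//=.
  by rewrite !hornerE subrr mul0r.
have WN : W.[N%:R] != 0.
  rewrite horner_prod; apply/prodf_neq0 => j _.
  by rewrite !hornerE subr_eq0 eqr_nat gtn_eqF.
exists (P + ((v N - P.[N%:R]) / W.[N%:R])%:P * W) => i.
rewrite ltnS leq_eqVlt => /orP[/eqP->|iN]; rewrite hornerD hornerM hornerC.
  by rewrite divfK// addrC subrK.
by rewrite (W0 i iN) mulr0 addr0 HP.
Qed.

Section SignCovering.
Variables (R : realType) (U V : normedModType R) (G : nat).
Variables (X : set U) (A : set V) (p : U -> V) (Phi : V -> ('I_G -> R) -> U).
Variable lab : 'I_G -> U -> R.
Let signs (e : {ffun 'I_G -> bool}) : 'I_G -> R := fun k => sgn R (e k).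

Hypothesis XP : forall u, X u <-> exists M e, A M /\ u = Phi M (signs e).
Hypothesis PhiK : forall M e, p (Phi M (signs e)) = M.
Hypothesis labP : forall M e k, lab k (Phi M (signs e)) = sgn R (e k).
Hypothesis smooth_p : smooth p.
Hypothesis smooth_lab : forall k, smooth (lab k).
Hypothesis smooth_Phi : forall E : 'I_G -> R -> R, (forall k, smooth (E k)) ->
  smooth (fun y : V * R => Phi y.1 (fun k => E k y.2)).

Let code (e : {ffun 'I_G -> bool}) : R := (nat_of_ord (enum_rank e))%:R.

Let label (u : U) : R :=
  \sum_e code e * \prod_k ((1 + sgn R (e k) * lab k u) / 2).

Let label_Phi M e : label (Phi M (signs e)) = code e.
Proof.
rewrite /label (bigD1 e)//= big1 => [|k _]; last first.
  by rewrite labP -expr2 sgn_sqr -[1 + 1]/2 divff.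
rewrite mulr1 big1 ?addr0// => e' e'e.
have [k ek] : exists k, e' k != e k.
  apply/existsP; rewrite -negb_forall; apply: contra e'e => /forallP h.
  by apply/eqP/ffunP => k; apply/eqP.
rewrite (bigD1 k)//= labP (_ : 1 + _ = 0) ?mul0r ?mulr0//.
by move: ek; case: (e' k); case: (e k) => //= _; rewrite /sgn; ring.
Qed.

(** If the points of [X] are parametrized by a point of [A] and a pattern of
    signs, and both can be recovered smoothly, then [X] is a trivial covering of
    [A]. As the fibre has to be a set of real numbers, a pattern is coded by its
    rank in an enumeration. The code is a polynomial in the signs (a sum of
    indicator products), and conversely the signs are polynomials in the code
    (by [interpolation]), so that both extend smoothly to the whole space. *)
Lemma sign_covering : smooth_finite_trivial_covering X A p.
Proof.
have [E EP] : exists E : 'I_G -> R -> R, (forall k, smooth (E k)) /\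
    (forall k e, E k (code e) = sgn R (e k)).
  have h k : exists P : {poly R}, forall e : {ffun 'I_G -> bool},
      P.[code e] = sgn R (e k).
    have [P HP] := @interpolation R #|{ffun 'I_G -> bool}|
      (fun i => sgn R (nth [ffun=> true] (enum {ffun 'I_G -> bool}) i k)).
    by exists P => e; rewrite HP// nth_enum_rank.
  have [P HP] := choice h; exists (fun k s => (P k).[s]); split=> // k.
  apply: (@smooth_horner _ _ (P k) id).
  by apply: (@smooth_linear _ _ _ idfun) => x; exact: cvg_id.
case: EP => sE EP.
exists (range code), (fun u => (p u, label u)); split=> //.
  exact: finite_image.
have smooth_label : smooth label.
  apply: smooth_sum => e; apply: smoothM; first exact: smooth_cst.
  apply: smooth_prod => k; apply: smoothM; last exact: smooth_cst.
  apply: smoothD; first exact: smooth_cst.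
  by apply: smoothM; first exact: smooth_cst.
pose g (y : V * R) := Phi y.1 (fun k => E k y.2).
have gP M e : g (M, code e) = Phi M (signs e).
  by rewrite /g /=; congr Phi; apply/funext => k; rewrite EP.
have gK u : X u -> g (p u, label u) = u.
  by move=> /XP[M [e [_ ->]]]; rewrite PhiK label_Phi gP.
split; [split | split].
- move=> u /XP[M [e [AM ->]]]; rewrite PhiK label_Phi; split=> //=.
  by exists e.
- by move=> u u' /set_mem Xu /set_mem Xu' uu'; rewrite -(gK u)// uu' gK.
- move=> [M s] [/= AM [e _ <-]]; exists (Phi M (signs e)).
    by apply/XP; exists M, e.
  by rewrite PhiK label_Phi.
- by exists (fun u => (p u, label u)) => //; exact: smooth_pair.
- by exists g; split=> //; exists g => //; exact: smooth_Phi.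
Qed.

End SignCovering.

(** * The linkage of a program *)

Section ProgramLinkage.
Variables (R : realType) (n : nat) (p : seq (instr R)) (o : nat).
Local Notation m := (n + n)%N.
Local Notation G := (size p).
Hypothesis pok : prog_ok m p.
Hypothesis o_lt : (o < 2 + m + G)%N.

(** The A-wires are the registers, followed by seven auxiliary wires for each
    instruction; the B-wires are the constants 0 and 1, followed by six
    auxiliary wires for each instruction. *)
Definition wireA : finType := ('I_(1 + m + G).+1 + 'I_G * 'I_7)%type.
Definition wireB : finType := ('I_2 + 'I_G * 'I_6)%type.
Definition reg (i : nat) : wireA := inl (inord i).

Local Notation ix k := (nth (instr0 R) p k).1.1.1.
Local Notation iy k := (nth (instr0 R) p k).1.1.2.
Local Notation lam k := (nth (instr0 R) p k).1.2.
Local Notation mu k := (nth (instr0 R) p k).2.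

Definition instr_bars (k : 'I_G) : seq (bar R wireA wireB) :=
  gate_bars (reg 0) (reg 1) (reg (ix k)) (reg (iy k)) (reg (2 + m + k))
    (inl ord0) (inl ord_max) (fun i => inr (k, i)) (fun j => inr (k, j))
    (lam k) (mu k).

(** The bar in front makes register [o] vanish. *)
Definition program_bars : seq (bar R wireA wireB) :=
  ((reg o, inl ord_max), (reg 0, inl ord0), 0) ::
  flatten [seq instr_bars k | k <- enum 'I_G].

Lemma program_bars_ok : all (@bar_ok R wireA wireB) program_bars.
Proof.
rewrite /= /bar_ok /= eqxx orbT /=; apply/allP => c /flattenP[s /mapP[k _ ->]].
move: c; apply/allP; apply: gate_bars_ok.
- by move=> i j [].
- by move=> i j [].
- by move=> i; rewrite !inE.
- by move=> j; rewrite !inE.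
Qed.

Lemma mem_program_bars k c : c \in instr_bars k -> c \in program_bars.
Proof.
move=> ck; rewrite inE; apply/orP; right; apply/flattenP.
by exists (instr_bars k) => //; apply: map_f; rewrite mem_enum.
Qed.

Section Assignment.
Variables (z : seq R) (e : 'I_G -> R).

Definition valueA (w : wireA) : R :=
  match w with
  | inl i => (run z p)`_i
  | inr (k, i) =>
    (gateA (run z p)`_(ix k) (run z p)`_(iy k) (lam k) (mu k) (e k))`_i
  end.

Definition valueB (w : wireB) : R :=
  match w with
  | inl j => (j : nat)%:R
  | inr (k, j) => (gateB (run z p)`_(ix k) (e k))`_j
  end.

Lemma valueA_reg i : (i < 2 + m + G)%N -> valueA (reg i) = (run z p)`_i.
Proof. by move=> h; rewrite /valueA /= inordK. Qed.

End Assignment.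

Lemma ix_lt k : (k < G)%N -> (ix k < 2 + m + G)%N.
Proof.
move=> kG; have /andP[h _] := pok kG.
by rewrite (leq_trans h)// leq_add2l ltnW.
Qed.

Lemma iy_lt k : (k < G)%N -> (iy k < 2 + m + G)%N.
Proof.
move=> kG; have /andP[_ h] := pok kG.
by rewrite (leq_trans h)// leq_add2l ltnW.
Qed.

Lemma instr_barsP (k : 'I_G) al be : al (reg 0) = 0 -> al (reg 1) = 1 ->
  be (inl ord0) = 0 -> be (inl ord_max) = 1 ->
  (forall c, c \in instr_bars k -> bar_holds al be c) <->
  al (reg (2 + m + k)) =
    al (reg (iy k)) + lam k * al (reg (ix k)) + mu k * al (reg (ix k)) ^+ 2 /\
  exists e : bool,
    (forall i, al (inr (k, i)) = (gateA (al (reg (ix k))) (al (reg (iy k)))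
                                    (lam k) (mu k) (sgn R e))`_i) /\
    (forall j, be (inr (k, j)) = (gateB (al (reg (ix k))) (sgn R e))`_j).
Proof. by move=> *; exact: gate_barsP. Qed.

Lemma program_wiring (al : wireA -> R) (be : wireB -> R) :
  wiring (reg 0) (reg 1) (inl ord0) (inl ord_max) program_bars al be <->
  exists z (e : {ffun 'I_G -> bool}),
    [/\ size z = m, (run z p)`_o = 0,
        al = valueA z (fun k => sgn R (e k)) &
        be = valueB z (fun k => sgn R (e k))].
Proof.
split=> [[[al0 al1] [be0 be1] H]|[z [e [zm zo -> ->]]]]; last first.
  have r0 : valueA z (fun k => sgn R (e k)) (reg 0) = 0.
    by rewrite valueA_reg// -[p]cat0s (@run_cat _ m)// addn0.
  have r1 : valueA z (fun k => sgn R (e k)) (reg 1) = 1.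
    by rewrite valueA_reg// -[p]cat0s (@run_cat _ m)// addn0.
  split=> // c; rewrite inE => /orP[/eqP->|].
    have ro : valueA z (fun k => sgn R (e k)) (reg o) = 0 by rewrite valueA_reg.
    have zero_prod (a b d : R) : a = 0 -> b = 0 -> (a - b) * d = 0.
      by move=> -> ->; rewrite subrr mul0r.
    exact: zero_prod ro r0.
  move=> /flattenP[s /mapP[k _ ->]]; move: c; apply/instr_barsP => //.
  have outk : (2 + m + k < 2 + m + G)%N by rewrite ltn_add2l.
  rewrite !valueA_reg// ?ix_lt ?iy_lt//; split.
    rewrite (run_output zm pok (ltn_ord k)).
    by case: (nth _ _ _) => -[[]].
  by exists (e k).
pose r i := al (reg i); pose z := mkseq (fun i => r (2 + i)%N) m.
have zm : size z = m by rewrite size_mkseq.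
have Hk (k : 'I_G) := iffLR (instr_barsP k al0 al1 be0 be1)
  (fun c ck => H c (mem_program_bars ck)).
have rE i : (i < 2 + m + G)%N -> r i = (run z p)`_i.
  apply: (run_unique zm pok) => // [j jm|k kG]; first by rewrite nth_mkseq.
  have [] := Hk (Ordinal kG); rewrite /r /=.
  by case: (nth _ _ _) => -[[]].
have [e eP] := choice (fun k => (Hk k).2).
exists z, [ffun k => e k]; split=> //.
- have := H _ (mem_head _ _); rewrite /bar_holds /= be0 be1 al0 !subr0 mulr1.
  by rewrite -[al _]/(r o) rE.
- apply/funext => -[i|[k i]] /=.
    by rewrite -(rE i)// /r /reg inord_val.
  by rewrite (eP k).1 ffunE -!rE ?ix_lt ?iy_lt.
- apply/funext => -[j|[k j]] /=.
    have [->|->] : j = ord0 \/ j = ord_max.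
      by case: j => -[|[|//]] h; [left|right]; exact/val_inj.
    + exact: be0.
    + exact: be1.
  by rewrite (eP k).2 ffunE -!rE ?ix_lt.
Qed.

End ProgramLinkage.

(** * Realization of algebraic sets *)

Section Inputs.
Variables (R : realType) (n : nat).

(** The inputs are the first light coordinates of the [n] points, followed by
    their second light coordinates. *)
Definition inputs (M : mink_pow R n) : seq R :=
  [seq lightA (row k M) | k <- enum 'I_n] ++ [seq lightB (row k M) | k <- enum 'I_n].

Definition points (z : seq R) : mink_pow R n :=
  \matrix_k light_point z`_k z`_(n + k).

Lemma size_inputs M : size (inputs M) = (n + n)%N.
Proof. by rewrite size_cat 2!size_map !size_enum_ord. Qed.

Lemma inputs_lightA M (k : 'I_n) : (inputs M)`_k = lightA (row k M).
Proof.
rewrite nth_cat size_map size_enum_ord ltn_ord (nth_map k) ?nth_ord_enum//.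
by rewrite size_enum_ord.
Qed.

Lemma inputs_lightB M (k : 'I_n) : (inputs M)`_(n + k) = lightB (row k M).
Proof.
rewrite nth_cat size_map size_enum_ord ltnNge leq_addr/= addKn.
by rewrite (nth_map k) ?nth_ord_enum// size_enum_ord.
Qed.

Lemma inputsK : cancel inputs points.
Proof.
move=> M; apply/row_matrixP => k.
by rewrite rowK inputs_lightA inputs_lightB light_pointK.
Qed.

Lemma pointsK z : size z = (n + n)%N -> inputs (points z) = z.
Proof.
move=> zm; apply: (@eq_from_nth _ 0); rewrite size_inputs// => i im.
have [h|h] := ltnP i n.
  by rewrite (inputs_lightA _ (Ordinal h)) rowK lightA_point.
have h' : (i - n < n)%N by rewrite ltn_subLR.
by rewrite -[in LHS](subnKC h) (inputs_lightB _ (Ordinal h')) rowK lightB_point/= subnKC.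
Qed.

Lemma smooth_inputs (U : normedModType R) (f : U -> mink_pow R n) i :
  (forall r c, smooth (fun u => f u r c)) -> smooth (fun u => (inputs (f u))`_i).
Proof.
move=> sf; have [im|im] := ltnP i (n + n); last first.
  have -> : (fun u => (inputs (f u))`_i) = (fun=> 0).
    by apply/funext => u; rewrite nth_default// size_inputs.
  exact: smooth_cst.
have [h|h] := ltnP i n.
  have -> : (fun u => (inputs (f u))`_i) =
      (fun u => f u (Ordinal h) 0 + f u (Ordinal h) 1).
    by apply/funext => u; rewrite (inputs_lightA _ (Ordinal h)) /lightA !mxE.
  exact: smoothD.
have h' : (i - n < n)%N by rewrite ltn_subLR.
have -> : (fun u => (inputs (f u))`_i) =
    (fun u => f u (Ordinal h') 0 - f u (Ordinal h') 1).
  apply/funext => u; rewrite -[in LHS](subnKC h) (inputs_lightB _ (Ordinal h')).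
  by rewrite /lightB !mxE.
exact: smoothB.
Qed.

End Inputs.

Section Realization.
Variables (R : realType) (n : nat) (p : seq (instr R)) (o : nat).
Local Notation m := (n + n)%N.
Local Notation G := (size p).
Hypothesis pok : prog_ok m p.
Hypothesis o_lt : (o < 2 + m + G)%N.
Hypothesis nG : (n <= G)%N.
Hypothesis p_conv : forall k, (k < n)%N ->
  nth (instr0 R) p k = ((2 + n + k)%N, 0%N, 0, 0).

Local Notation ix k := (nth (instr0 R) p k).1.1.1.

Definition program_linkage : linkage R :=
  grid_linkage (reg n p 0) (reg n p 1) (inl ord0 : wireB p) (inl ord_max)
    (program_bars n p o).

Definition site (a : wireA n p) (b : wireB p) : program_linkage := ((a, b), ord0).

(** The first [n] instructions only serve to copy the second light coordinates
    to B-wires: [ord_max] is the B-wire of a gate that carries a copy of its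
    input. *)
Definition output_vertex (k : 'I_n) : program_linkage :=
  site (reg n p (2 + k)) (inr (widen_ord nG k, ord_max)).

Definition solution (M : mink_pow R n) (e : 'I_G -> R) :
    mink_pow R #|program_linkage| :=
  @grid_conf R (wireA n p) (wireB p) (program_bars n p o)
    (valueA (inputs M) e) (valueB (inputs M) e).

Lemma Conf_program phi : Conf program_linkage phi <->
  exists M (e : {ffun 'I_G -> bool}),
    (run (inputs M) p)`_o = 0 /\ phi = solution M (fun k => sgn R (e k)).
Proof.
have a01 : reg n p 0 != reg n p 1.
  by apply/eqP => -[] /(congr1 val); rewrite /= !inordK.
have b01 : (inl ord0 : wireB p) != inl ord_max by [].
split=> [/(grid_Conf a01 b01 (program_bars_ok n p o))|].
  move=> [al [be [/(program_wiring pok o_lt)[z [e [zm zo -> ->]]] ->]]].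
  by exists (points n z), e; rewrite /solution pointsK.
move=> [M [e [Mo ->]]].
apply/(grid_Conf a01 b01 (program_bars_ok n p o)).
exists (valueA (inputs M) (fun k => sgn R (e k))),
  (valueB (inputs M) (fun k => sgn R (e k))); split=> //.
apply/(program_wiring pok o_lt); exists (inputs M), e; split=> //.
exact: size_inputs.
Qed.

Lemma restr_solution M e : restr output_vertex (solution M e) = M.
Proof.
rewrite -[RHS](inputsK M); apply/row_matrixP => k; rewrite !rowK pos_grid_conf.
have kG : (k < G)%N by rewrite (leq_trans (ltn_ord k)).
congr light_point.
  rewrite valueA_reg; last by rewrite ltn_add2l ltn_addr// ltn_addr.
  by rewrite (run_input (m := m)) ?size_inputs// ltn_addr.
rewrite /= p_conv//= -addnA (run_input (m := m)) ?size_inputs//.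
by rewrite ltn_add2l.
Qed.

Lemma output_vertex_inj : injective output_vertex.
Proof. by move=> i j [] _ /ord_inj. Qed.

(** The sign of gate [k] is recovered from [sg = (1 + e * sqrt s) / 2]; the
    wire 2 of the gate carries [sg], and [sqrt s] is a smooth function of the
    input of the gate. *)
Definition sheet (k : 'I_G) (phi : mink_pow R #|program_linkage|) : R :=
  (2 * lightA (pos phi (site (inr (k, @Ordinal 7 2 isT)) (inl ord0))) - 1) /
  gate_root (lightA (pos phi (site (reg n p (ix k)) (inl ord0)))).

Lemma sheet_solution M e k : sheet k (solution M e) = e k.
Proof.
rewrite /sheet !pos_grid_conf !lightA_point valueA_reg; last exact: ix_lt.
have := gate_root_gt0 (run (inputs M) p)`_(ix k) => w0.
by rewrite /=; field; rewrite gt_eqF.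
Qed.

Lemma smooth_lightA_pos (v : program_linkage) :
  smooth (fun phi : mink_pow R #|program_linkage| => lightA (pos phi v)).
Proof.
rewrite /lightA /pos; under eq_fun do rewrite !mxE.
by apply: smoothD; exact: smooth_coord.
Qed.

Lemma smooth_sheet k : smooth (sheet k).
Proof.
apply: smoothM.
  apply: smoothB; last exact: smooth_cst.
  by apply: smoothM; [exact: smooth_cst | exact: smooth_lightA_pos].
apply: smoothV => [phi|]; first by rewrite gt_eqF// gate_root_gt0.
by apply: smooth_gate_root; exact: smooth_lightA_pos.
Qed.

Lemma smooth_restr : smooth (@restr R _ n output_vertex).
Proof.
apply: smooth_mx => i j; rewrite /restr /pos; under eq_fun do rewrite !mxE.
exact: smooth_coord.
Qed.

Lemma smooth_solution (E : 'I_G -> R -> R) : (forall k, smooth (E k)) ->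
  smooth (fun y : mink_pow R n * R => solution y.1 (fun k => E k y.2)).
Proof.
move=> sE.
have sz i : smooth (fun y : mink_pow R n * R => (inputs y.1)`_i).
  by apply: smooth_inputs => r c; exact: smooth_fst_coord.
have srun i : smooth (fun y : mink_pow R n * R => (run (inputs y.1) p)`_i).
  by apply: (@smooth_run _ m) => // y; exact: size_inputs.
have sEy k : smooth (fun y : mink_pow R n * R => E k y.2).
  apply: (@smooth_comp_linear _ _ _ _ snd (E k)) => // y; exact: cvg_snd.
have sA (a : wireA n p) :
    smooth (fun y : mink_pow R n * R =>
      valueA (inputs y.1) (fun k => E k y.2) a).
  case: a => [i|[k i]] /=; first exact: srun.
  by apply: smooth_gateA.
have sB (b : wireB p) :
    smooth (fun y : mink_pow R n * R =>
      valueB (inputs y.1) (fun k => E k y.2) b).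
  case: b => [i|[k i]] /=; first exact: smooth_cst.
  by apply: smooth_gateB.
apply: smooth_mx => i j; rewrite /solution /grid_conf /light_point.
under eq_fun do rewrite !mxE.
case: (j == 0); (apply: smoothM; last exact: smooth_cst).
  exact: smoothD.
exact: smoothB.
Qed.

End Realization.

Lemma computable_realization (R : realType) (n : nat) (f : seq R -> R)
    (A : set (mink_pow R n)) :
  computable (n + n) f -> (forall M, A M <-> f (inputs M) = 0) ->
  exists (L : linkage R) (w : 'I_n -> L),
    [/\ injective w, partial_Conf w = A &
        smooth_finite_trivial_covering (Conf L) A (restr w)].
Proof.
move=> cf AE.
pose conv := mkseq (fun k => ((2 + n + k)%N, 0%N, 0, 0) : instr R) n.
have conv_ok : prog_ok (n + n) conv.
  move=> k; rewrite size_mkseq => kn; rewrite nth_mkseq//; apply/andP; split=> //.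
  have : (2 + n + k < 2 + (n + n) + k)%N.
    by rewrite ltn_add2r ltn_add2l -[X in (X < _)%N]addn0 ltn_add2l (leq_ltn_trans _ kn).
  by [].
have [p' [ o [ok o_lt oE]]] := cf _ conv_ok.
set p := conv ++ p' in ok o_lt oE.
have nG : (n <= size p)%N by rewrite size_cat size_mkseq leq_addr.
have p_conv k : (k < n)%N -> nth (instr0 R) p k = ((2 + n + k)%N, 0%N, 0, 0).
  by move=> kn; rewrite nth_cat size_mkseq kn nth_mkseq.
have ConfP phi : Conf (program_linkage n p o) phi <->
    exists M (e : {ffun 'I_(size p) -> bool}),
      A M /\ phi = solution o M (fun k => sgn R (e k)).
  split=> [/(Conf_program ok o_lt)|] [M [e [MA ->]]].
    by exists M, e; split=> //; apply/AE; rewrite -oE// size_inputs.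
  apply/(Conf_program ok o_lt); exists M, e; split=> //.
  by rewrite oE ?size_inputs//; apply/AE.
exists (program_linkage n p o), (@output_vertex R n p o nG); split.
- exact: output_vertex_inj.
- apply/seteqP; split=> [_ [phi /ConfP[M [e [AM ->]]] <-]|M AM].
    by rewrite restr_solution.
  exists (solution o M (fun k => sgn R ([ffun=> true] k))).
    by apply/ConfP; exists M, [ffun=> true].
  by rewrite restr_solution.
- apply: (sign_covering ConfP (lab := @sheet R n p o)).
  + by move=> M e; exact: restr_solution.
  + by move=> M e k; exact: sheet_solution.
  + exact: smooth_restr.
  + by move=> k; exact: smooth_sheet.
  + by move=> E sE; exact: smooth_solution.
Qed.

(** Over the reals a system of equations amounts to a single one, the sum of
    the squares. *)
Lemma computable_zeros (R : realType) (m k r : nat) (f : 'I_r -> mpoly.mpoly k R)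
    (v : 'I_k -> seq R -> R) :
  (forall i, computable m (v i)) ->
  exists2 F, computable m F &
    forall z, F z = 0 <-> forall j, mpoly.meval (v^~ z) (f j) = 0.
Proof.
move=> cv; exists (fun z => \sum_j mpoly.meval (v^~ z) (f j) ^+ 2).
  by apply: computable_sum => j; apply: computableX; exact: computable_meval.
move=> z; split=> [/eqP|f0]; last by rewrite big1 // => j _; rewrite f0 expr0n.
rewrite psumr_eq0 => [/allP h j|j _]; last exact: sqr_ge0.
by have := h j (mem_index_enum j); rewrite sqrf_eq0 => /eqP.
Qed.

Lemma computable_points (R : realType) n (i : 'I_n) (c : 'I_2) :
  computable (n + n) (fun z : seq R => points n z i c).
Proof.
have ci : computable (n + n) (fun z : seq R => z`_i).
  by apply: computable_var; rewrite ltn_addr.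
have cn : computable (n + n) (fun z : seq R => z`_(n + i)).
  by apply: computable_var; rewrite ltn_add2l.
under eq_fun do rewrite /points /light_point !mxE.
case: (c == 0); apply: computableM => //; try exact: computable_cst.
  exact: computableD.
apply: computableD => //; under eq_fun do rewrite -mulN1r.
by apply: computableM => //; exact: computable_cst.
Qed.

Lemma computable_mxvec (R : realType) n k (M : seq R -> mink_pow R n) l :
  (forall i c, computable k (fun z => M z i c)) ->
  computable k (fun z => mxvec (M z) 0 l).
Proof.
move=> cM; case/mxvec_indexP: l => i c.
by under eq_fun do rewrite mxvecE; exact: cM.
Qed.

Lemma algebraic_realization (R : realType) (n : nat) (A : set (mink_pow R n)) :
  mink_algebraic A ->
  exists (L : linkage R) (w : 'I_n -> L),
    [/\ injective w, partial_Conf w = A &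
        smooth_finite_trivial_covering (Conf L) A (restr w)].
Proof.
move=> [r [f AE]].
have [F cF F0] := computable_zeros f
  (fun l => computable_mxvec l (@computable_points R n)).
apply: (computable_realization cF) => M; rewrite F0 inputsK.
have -> : A M <-> (mxvec @` A) (mxvec M).
  split=> [AM|[M' AM' /(can_inj mxvecK) <-//]].
  by exists M.
by rewrite AE.
Qed.

Theorem theorem1p4 (R : realType) (n : nat) (hn : (1 <= n)%N)
    (A : set (mink_pow R n)) :
  (mink_semialgebraic A ->
     exists (L : linkage R) (w : 'I_n -> L),
       injective w /\ partial_Conf w = A) /\
  (mink_algebraic A ->
     exists (L : linkage R) (w : 'I_n -> L),
       [/\ injective w,
           partial_Conf w = A &
           smooth_finite_trivial_covering (Conf L) A (restr w)]).
Proof.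
split; last exact: algebraic_realization.
move=> [d [Y [[r [f YE]] AY]]].
(* The d auxiliary variables of Y are carried by the first coordinates of d
   additional points, whose other coordinates stay free. *)
pose flat (M : mink_pow R (n + d)) : 'rV[R]_(n * 2 + d) :=
  row_mx (mxvec (usubmx M)) (\row_k dsubmx M k 0).
have cflat l :
    computable (n + d + (n + d)) (fun z : seq R => flat (points (n + d) z) 0 l).
  rewrite /flat; case: (split_ordP l) => k ->.
    under eq_fun do rewrite row_mxEl.
    apply: computable_mxvec => i c.
    have -> : (fun z : seq R => usubmx (points (n + d) z) i c) =
        (fun z => points (n + d) z (lshift d i) c).
      by apply/funext => z; rewrite [LHS]mxE.
    exact: computable_points.
  have -> : (fun z : seq R => row_mx (mxvec (usubmx (points (n + d) z)))
      (\row_k0 dsubmx (points (n + d) z) k0 0) 0 (rshift _ k)) =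
      (fun z => points (n + d) z (rshift n k) 0).
    by apply/funext => z; rewrite row_mxEr mxE [LHS]mxE.
  exact: computable_points.
have [F cF F0] := computable_zeros f cflat.
have flatP M : (flat @^-1` Y) M <-> F (inputs M) = 0.
  by rewrite F0 inputsK /preimage /= YE.
have [L [w [winj wA _]]] := computable_realization (A := flat @^-1` Y) cF flatP.
exists L, (w \o lshift d); split.
  by move=> i j /winj /lshift_inj.
have restrE phi : restr (w \o lshift d) phi = usubmx (restr w phi).
  by apply/row_matrixP => i; apply/rowP => c; rewrite !mxE.
have AYE M : A M <-> exists2 y, Y y & lsubmx y = mxvec M.
  have -> : A M <-> (mxvec @` A) (mxvec M).
    by split=> [AM|[M' AM' /(can_inj mxvecK) <-//]]; exists M.
  by rewrite AY.
apply/seteqP; split=> [_ [phi Lphi <-]|M /AYE[y Yy yM]].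
  have : partial_Conf w (restr w phi) by exists phi.
  rewrite wA => Yphi; apply/AYE; exists (flat (restr w phi)) => //.
  by rewrite row_mxKl restrE.
pose M' : mink_pow R (n + d) := col_mx M (\matrix_(k, c) rsubmx y 0 k).
have : partial_Conf w M'.
  rewrite wA /preimage /= /flat col_mxKu col_mxKd -yM.
  rewrite (_ : (\row_k _) = rsubmx y) ?hsubmxK//.
  by apply/rowP => k; rewrite !mxE.
move=> [phi Lphi phiM]; exists phi => //.
by rewrite restrE phiM col_mxKu.
Qed.
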